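(* For every $f\in\mathcal{PR}$ there is $g\in\mathcal{OR}$ such that $Q(g)=f$, i.e. $f(x_1,\dots,x_m)(y)=\mu(\{\omega\in\mathbb{B}^{\mathbb{N}}\mid g(x_1,\dots,x_m,\omega)=y\})$ for all $x_1,\dots,x_m,y\in\mathbb{N}$.
   Context: $\mathbb{B}=\{0,1\}$; $\mu$ is the standard (coin-flipping) probability measure on the Borel $\sigma$-algebra of $\mathbb{B}^{\mathbb{N}}$ generated by cylinders, with $\mu$ of the set of sequences with a prescribed prefix of length $n$ equal to $2^{-n}$. $\mathcal{D}(\mathbb{N})$ is the set of functions $d:\mathbb{N}\to[0,1]$ with $\sum_nd(n)\le1$. $\mathcal{PR}$ is the smallest class of functions $\mathbb{N}^k\to\mathcal{D}(\mathbb{N})$ containing: zero $z(x)(0)=1$; successor $s(x)(x+1)=1$; projections $\pi^n_m(x_1,\dots,x_n)(x_m)=1$; fair coin $r(x)(x)=r(x)(x+1)=1/2$ (and $0$ elsewhere) (unspecified values being $0$); and closed under probabilistic composition $(f\bullet(g_1,\dots,g_n))(\vec x)(y)=\sum_{z_1,\dots,z_n}\prod_ig_i(\vec x)(z_i)\cdot f(z_1,\dots,z_n)(y)$, probabilistic primitive recursion $h(\vec x,0)=f(\vec x)$, $h(\vec x,y+1)(z)=\sum_w h(\vec x,y)(w)\cdot g(\vec x,y,w)(z)$, and probabilistic minimization $\mu f(\vec x)(y)=f(\vec x,y)(0)\cdot\prod_{z<y}\sum_{k>0}f(\vec x,z)(k)$. $\mathcal{OR}$ is the smallest class of partial functions $\mathbb{N}^n\times\mathbb{B}^{\mathbb{N}}\rightharpoonup\mathbb{N}$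 containing the zero function $(\vec x,\omega)\mapsto0$, successor $(x,\omega)\mapsto x+1$, projections $(x_1,\dots,x_k,\omega)\mapsto x_i$, and the query function $q(x,\omega)=\omega(x)$, and closed under composition $f(\vec x,\omega)=h(g_1(\vec x,\omega),\dots,g_n(\vec x,\omega),\omega)$, primitive recursion $f(0,\vec x,\omega)=h(\vec x,\omega)$, $f(x+1,\vec x,\omega)=g(f(x,\vec x,\omega),x,\vec x,\omega)$, and minimization $f(\vec x,\omega)=\mu x.(g(\vec x,x,\omega)=0)$ (the oracle $\omega$ being passed unchanged). For $f\in\mathcal{OR}$ of arity $m$, $Q(f):\mathbb{N}^m\to\mathcal{D}(\mathbb{N})$ is $Q(f)(\vec x)(y)=\mu(\{\omega\mid f(\vec x,\omega)=y\})$. *)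

(* Defs.v *)
From HB Require Import structures.
From mathcomp Require Import all_boot all_order all_algebra.
From mathcomp Require Import all_classical all_reals all_analysis.
From mathcomp Require Import lra.

Set Implicit Arguments.
Unset Strict Implicit.
Unset Printing Implicit Defensive.

Import Order.TTheory GRing.Theory Num.Theory.
Import numFieldNormedType.Exports.

Local Open Scope classical_set_scope.
Local Open Scope ring_scope.

Definition cylinder (s : seq bool) : set (nat -> bool) :=
  [set w | forall i, (i < size s)%N -> w i = nth false s i].

Definition Bseq := g_sigma_algebraType (range cylinder).

Section CoinMeasure.
Variable R : realType.

(* Binary digits of x in [0, 1[; the sequence 000... outside this interval. *)
Definition digits (x : R) : Bseq :=
  fun i => (0 <= x < 1) && odd (Num.truncn (2 ^+ i.+1 * x)).

Definition bin_val (s : seq bool) : nat := foldl (fun k (b : bool) => k.*2 + b)%N 0%N s.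

Lemma truncn_double (x : R) : 0 <= x -> Num.truncn x = (Num.truncn (2 * x))./2.
Proof.
move=> x0; have /andP[lo hi] := truncn_itv (mulr_ge0 (ler0n R 2) x0).
apply: truncn_def; set k := Num.truncn _ in lo hi *.
have kE : k%:R = (odd k)%:R + 2 * (k./2)%:R :> R.
  by rewrite -{1}(odd_double_half k) natrD -muln2 natrM mulrC [X in _ + X]mulrC.
move: lo hi; rewrite -[k.+1]addn1 -[k./2.+1]addn1 !natrD kE.
by case: (odd k) => /=; rewrite ?mulr1n ?mulr0n => lo hi; apply/andP; split; lra.
Qed.

Lemma bin_val_rcons s b : bin_val (rcons s b) = ((bin_val s).*2 + b)%N.
Proof. by rewrite /bin_val foldl_rcons. Qed.

Lemma bin_val_lt s : (bin_val s < 2 ^ size s)%N.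
Proof.
elim/last_ind: s => [|s b IH] //.
rewrite bin_val_rcons size_rcons expnS mul2n.
by case: b; rewrite ?addn1 ?addn0 ?ltn_double ?ltn_Sdouble.
Qed.

Lemma cylinder_rcons s b (w : nat -> bool) :
  cylinder (rcons s b) w <-> cylinder s w /\ w (size s) = b.
Proof.
split=> [H|[H1 H2] i].
  split=> [i isz|].
    have := H i; rewrite size_rcons nth_rcons isz; apply.
    by rewrite ltnS ltnW.
  by have := H (size s); rewrite size_rcons nth_rcons ltnn eqxx; apply.
rewrite size_rcons nth_rcons ltnS leq_eqVlt => /orP[/eqP ->|isz].
  by rewrite ltnn eqxx.
by rewrite isz H1.
Qed.

Lemma digits_cylinder (x : R) s : 0 <= x < 1 ->
  cylinder s (digits x) <-> Num.truncn (2 ^+ size s * x) = bin_val s.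
Proof.
move=> x01; have /andP[x0 x1] := x01.
elim/last_ind: s => [|s b IH].
  rewrite /= expr0 mul1r; split=> // _.
  by apply: truncn_def; rewrite x0.
rewrite size_rcons bin_val_rcons.
have -> : cylinder (rcons s b) (digits x) <->
    cylinder s (digits x) /\ digits x (size s) = b by exact: cylinder_rcons.
have T0 : 0 <= 2 ^+ size s * x :> R by rewrite mulr_ge0 ?exprn_ge0.
rewrite IH /digits x01 (truncn_double T0) mulrA -exprS /=.
set k := Num.truncn _; split=> [[<- <-]|->].
  by rewrite addnC odd_double_half.
by rewrite addnC half_bit_double oddD odd_double addbF oddb.
Qed.

Definition dyadic (s : seq bool) : set R :=
  `[(bin_val s)%:R / 2 ^+ size s, (bin_val s).+1%:R / 2 ^+ size s[.

Lemma digits_preimage s :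
  (digits @^-1` (cylinder s)) `&` `[0, 1[ = dyadic s.
Proof.
have p0 : 0 < 2 ^+ size s :> R by rewrite exprn_gt0.
apply/seteqP; split=> x /=; rewrite /dyadic /= !in_itv /=.
  move=> [cx x01]; have /andP[x0 _] := x01.
  move/(digits_cylinder s x01): cx => /eqP.
  rewrite truncn_eq ?mulr_ge0 ?exprn_ge0 //.
  by rewrite ler_pdivrMr // ltr_pdivlMr // mulrC.
move=> H; have x01 : 0 <= x < 1.
  move: H => /andP[lo hi]; apply/andP; split.
    by apply: le_trans lo; rewrite divr_ge0 // ltW.
  apply: lt_le_trans hi _; rewrite ler_pdivrMr // mul1r -natrX ler_nat.
  exact: bin_val_lt.
split=> //; apply/(digits_cylinder s x01)/eqP; have /andP[x0 _] := x01.
rewrite truncn_eq ?mulr_ge0 ?exprn_ge0 //.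
by move: H; rewrite ler_pdivrMr // ltr_pdivlMr // mulrC.
Qed.

Lemma measurable_digits : measurable_fun [set: R] digits.
Proof.
apply: (@measurability _ _ R Bseq setT digits (range cylinder)) => //.
move=> _ [_ [s _ <-] <-]; rewrite setTI.
rewrite -(setIT (_ @^-1` _)) -(setUv `[0 : R, 1[%classic) setIUr; apply: measurableU.
  by rewrite digits_preimage; exact: measurable_itv.
have dig0 x : ~ (`[0 : R, 1[%classic : set R) x -> digits x = fun=> false.
  by rewrite /= in_itv /= => /negP/negbTE x01; apply/funext => i; rewrite /digits x01.
have [c0|c0] := pselect (cylinder s (fun=> false)).
  rewrite (_ : _ `&` _ = ~` `[0 : R, 1[%classic); first by apply: measurableC; exact: measurable_itv.
  by apply/seteqP; split=> [x []//|x nx]; split=> //=; rewrite dig0.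
rewrite (_ : _ `&` _ = set0) //; apply/seteqP; split=> x //= [cx nx].
by apply: c0; rewrite -(dig0 x nx).
Qed.

Lemma coin_measure_exists : exists mu : probability Bseq R,
  forall s : seq bool, mu (cylinder s) = (2^-1 ^+ size s)%:E.
Proof.
have mI : measurable (`[0 : R, 1[ : set R) by exact: measurable_itv.
pose leb := mrestr (@lebesgue_measure R) mI.
pose nu_of : {measure set Bseq -> \bar R} := pushforward leb digits.
pose nu : {measure set Bseq -> \bar R} := nu_of measurable_digits.
have nuE s : nu (cylinder s) = (2^-1 ^+ size s)%:E.
  rewrite /nu /nu_of /= /pushforward /leb /mrestr digits_preimage lebesgue_measure_itv /=.
  have p0 : 0 < 2 ^+ size s :> R by rewrite exprn_gt0.
  rewrite lte_fin ltr_pM2r ?invr_gt0 // ltr_nat ltnSn -EFinB -mulrBl.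
  by rewrite -natrB ?leqnSn // subSnn mul1r exprVn.
have nuT : nu setT = 1%E.
  rewrite (_ : setT = cylinder [::]); first by rewrite nuE expr0.
  by apply/seteqP; split=> w //= _ i.
pose P : probability Bseq R := HB.pack (nu : set Bseq -> \bar R) nu (Measure_isProbability.Build _ _ _ _ nuT).
by exists P.
Qed.

(* On the sigma-algebra of Bseq there is exactly one such measure: the cylinders
   generate it and, with the empty set, are closed under intersection. *)
Definition coin_measure : probability Bseq R := sval (cid coin_measure_exists).

Lemma coin_measure_cylinder s : coin_measure (cylinder s) = (2^-1 ^+ size s)%:E.
Proof. exact: (svalP (cid coin_measure_exists)). Qed.

End CoinMeasure.

Record subdistr (R : realType) (T : choiceType) := Subdistr {
  sd_fun :> T -> R;
  sd_itv : forall t, 0 <= sd_fun t <= 1;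
  sd_sum : (\esum_(t in [set: T]) (sd_fun t)%:E <= 1)%E }.

Section Subdistributions.
Variable R : realType.
Local Notation D T := (subdistr R T).

Lemma esum_ub (T : choiceType) (p : T -> R) (c : R) (A : set T) (t : T) :
  (forall t, 0 <= p t) -> A t ->
  (\esum_(t in A) (p t)%:E <= c%:E)%E -> p t <= c.
Proof.
move=> p0 At; rewrite -lee_fin; apply: le_trans.
have <- : (\esum_(u in [set t]) (p u)%:E = (p t)%:E)%E.
  by rewrite esum_set1 ?lee_fin.
rewrite [leLHS]esum_mkcond [leRHS]esum_mkcond.
apply: le_esum => u _; case: ifPn; last by case: ifPn; rewrite ?lee_fin.
by rewrite inE => /= ->; rewrite mem_set.
Qed.

Definition mk_subdistr (T : choiceType) (p : T -> R) (p0 : forall t, 0 <= p t)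
    (p1 : (\esum_(t in [set: T]) (p t)%:E <= 1)%E) : D T :=
  Subdistr (fun t => introT andP (conj (p0 t) (esum_ub (t := t) p0 I p1))) p1.

Lemma sd_ge0 (T : choiceType) (d : D T) t : 0 <= d t.
Proof. by case/andP: (sd_itv d t). Qed.

Lemma esumZ_le (T : choiceType) (d : D T) (c : R) : 0 <= c ->
  (\esum_(t in [set: T]) (c * d t)%:E <= c%:E)%E.
Proof.
move=> c0; apply: ge_ereal_sup => _ [A [fA _] <-].
under eq_fsbigr do rewrite EFinM.
rewrite -ge0_mule_fsumr; last by move=> t; rewrite lee_fin sd_ge0.
rewrite -[leRHS]mule1 lee_wpmul2l ?lee_fin //.
apply: le_trans (sd_sum d); apply: ereal_sup_ubound; by exists A.
Qed.

Lemma sd_tail_le (d : D nat) :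
  ((d 0%N)%:E + \esum_(k in [set k | (0 < k)%N]) (d k)%:E <= 1)%E.
Proof.
apply: le_trans (sd_sum d).
rewrite [leRHS](esumID [set 0%N]); last by move=> k _; rewrite lee_fin sd_ge0.
rewrite !setTI esum_set1 ?lee_fin ?sd_ge0 // leeD2l //.
rewrite (_ : ~` _ = [set k | (0 < k)%N]) //.
by apply/seteqP; split=> -[|k] //= /(_ erefl).
Qed.

Section Dirac.
Variables (T : choiceType) (a : T).

Definition dirac_fun (t : T) : R := (t == a)%:R.

Lemma dirac_fun_ge0 t : 0 <= dirac_fun t. Proof. exact: ler0n. Qed.

Lemma dirac_fun_sum : (\esum_(t in [set: T]) (dirac_fun t)%:E <= 1)%E.
Proof.
rewrite (esumID [set a]); last by move=> t _; rewrite lee_fin dirac_fun_ge0.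
rewrite !setTI esum_set1 ?lee_fin ?dirac_fun_ge0 // esum1 => [|t /= /eqP/negbTE].
  by rewrite adde0 /dirac_fun eqxx.
by rewrite /dirac_fun => ->.
Qed.

Definition sd_dirac : D T := mk_subdistr dirac_fun_ge0 dirac_fun_sum.
End Dirac.

Section Coin.
Variable x : nat.

Definition coin_fun (y : nat) : R :=
  if (y == x) || (y == x.+1) then 1 / 2 else 0.

Lemma coin_fun_ge0 y : 0 <= coin_fun y.
Proof. by rewrite /coin_fun; case: ifP => _ //; rewrite divr_ge0. Qed.

Lemma coin_fun_sum : (\esum_(y in [set: nat]) (coin_fun y)%:E <= 1)%E.
Proof.
have c0 y : (0 <= (coin_fun y)%:E)%E by rewrite lee_fin coin_fun_ge0.
rewrite (esumID [set x]) // !setTI esum_set1 //.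
rewrite (esumID [set x.+1]) //.
rewrite (_ : ~` [set x] `&` [set x.+1] = [set x.+1]); last first.
  by apply/seteqP; split=> y /= => [[]//|->]; split=> // /eqP; rewrite gtn_eqF.
rewrite esum_set1 // esum1 => [|y [/eqP/negbTE yx /eqP/negbTE yx1]].
  by rewrite /coin_fun !eqxx orbT adde0 -EFinD lee_fin; lra.
by rewrite /coin_fun yx yx1.
Qed.

Definition sd_coin : D nat := mk_subdistr coin_fun_ge0 coin_fun_sum.
End Coin.

Section Bind.
Variables (T : choiceType) (p : D T) (k : T -> D nat).

Definition bind_fun (y : nat) : R :=
  fine (\esum_(t in [set: T]) (p t * k t y)%:E).

Lemma bind_fun_ge0 y : 0 <= bind_fun y.
Proof.
by apply/fine_ge0/esum_ge0 => t _; rewrite lee_fin mulr_ge0 ?sd_ge0.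
Qed.

Lemma bind_fun_fin y :
  (bind_fun y)%:E = \esum_(t in [set: T]) (p t * k t y)%:E.
Proof.
apply: fineK; rewrite ge0_fin_numE.
  apply: (@le_lt_trans _ _ 1%E); last exact: ltry.
  apply: le_trans (sd_sum p); apply: le_esum => t _; rewrite lee_fin.
  by rewrite ler_piMr ?sd_ge0 //; case/andP: (sd_itv (k t) y).
by apply: esum_ge0 => t _; rewrite lee_fin mulr_ge0 ?sd_ge0.
Qed.

Lemma bind_fun_sum : (\esum_(y in [set: nat]) (bind_fun y)%:E <= 1)%E.
Proof.
under eq_esum do rewrite bind_fun_fin.
have pk0 t y : (0 <= (p t * k t y)%:E)%E by rewrite lee_fin mulr_ge0 ?sd_ge0.
rewrite esum_esum //.
rewrite (reindex_esum ([set: T] `*`` fun=> [set: nat]) _ (fun u => (u.2, u.1))).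
  rewrite -(esum_esum (a := fun t y => (p t * k t y)%:E)) //.
  apply: le_trans (sd_sum p); apply: le_esum => t _.
  exact: esumZ_le (sd_ge0 p t).
by split=> [[t y]|[t y] [t' y'] _ _ [-> ->]|[y t] _] //=; exists (t, y).
Qed.

Definition sd_bind : D nat := mk_subdistr bind_fun_ge0 bind_fun_sum.
End Bind.

Section Product.

Definition prod_fun n (p : 'I_n -> D nat) (z : n.-tuple nat) : R :=
  \prod_(i < n) p i (tnth z i).

Lemma prod_fun_ge0 n (p : 'I_n -> D nat) z : 0 <= prod_fun p z.
Proof. by apply: prodr_ge0 => i _; exact: sd_ge0. Qed.

Lemma prod_fun_sum n (p : 'I_n -> D nat) :
  (\esum_(z in [set: n.-tuple nat]) (prod_fun p z)%:E <= 1)%E.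
Proof.
elim: n p => [|n IH] p.
  rewrite (_ : setT = [set [tuple]]).
    by rewrite esum_set1 ?lee_fin ?prod_fun_ge0 // /prod_fun big_ord0.
  by apply/seteqP; split=> z //= _; rewrite tuple0.
pose tl : D (n.-tuple nat) :=
  mk_subdistr (prod_fun_ge0 (fun i => p (lift ord0 i))) (IH _).
rewrite (reindex_esum ([set: nat] `*`` fun=> [set: n.-tuple nat]) _
  (fun u => [tuple of u.1 :: u.2])).
  rewrite (eq_esum (b := fun u => (p ord0 u.1 * tl u.2)%:E)); last first.
    move=> [a z] _ /=; rewrite /prod_fun big_ord_recl tnth0.
    by under eq_bigr do rewrite tnthS.
  rewrite -(esum_esum (a := fun a z => (p ord0 a * tl z)%:E)); last first.
    by move=> a z _ _; rewrite lee_fin mulr_ge0 ?sd_ge0.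
  apply: le_trans (sd_sum (p ord0)); apply: le_esum => a _.
  exact: esumZ_le (sd_ge0 _ a).
split=> [//|[a z] [a' z'] _ _ /(congr1 val) [-> /val_inj -> //]|z _].
by exists (thead z, [tuple of behead z]) => //=; rewrite -tuple_eta.
Qed.

Definition sd_prod n (p : 'I_n -> D nat) : D (n.-tuple nat) :=
  mk_subdistr (prod_fun_ge0 p) (prod_fun_sum p).
End Product.

Section Minimization.
Variable F : nat -> D nat.

Definition pos_mass (d : D nat) : R :=
  fine (\esum_(k in [set k | (0 < k)%N]) (d k)%:E).

Definition min_fun (y : nat) : R := F y 0%N * \prod_(z < y) pos_mass (F z).

Lemma pos_mass_ge0 (d : D nat) : 0 <= pos_mass d.
Proof. by apply/fine_ge0/esum_ge0 => k _; rewrite lee_fin sd_ge0. Qed.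

Lemma pos_mass_le (d : D nat) : d 0%N + pos_mass d <= 1.
Proof.
have t0 : (0 <= \esum_(k in [set k | (0 < k)%N]) (d k)%:E)%E.
  by apply: esum_ge0 => k _; rewrite lee_fin sd_ge0.
have dt := sd_tail_le d.
rewrite -lee_fin EFinD /pos_mass fineK // ge0_fin_numE //.
apply: (@le_lt_trans _ _ 1%E); last exact: ltry.
by apply: le_trans dt; rewrite leeDr // lee_fin sd_ge0.
Qed.

Lemma min_fun_ge0 y : 0 <= min_fun y.
Proof.
by rewrite mulr_ge0 ?sd_ge0 // prodr_ge0 // => z _; exact: pos_mass_ge0.
Qed.

Lemma min_fun_sum : (\esum_(y in [set: nat]) (min_fun y)%:E <= 1)%E.
Proof.
have H n : \sum_(y < n) min_fun y + \prod_(z < n) pos_mass (F z) <= 1.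
  elim: n => [|n IH]; first by rewrite !big_ord0 add0r.
  apply: le_trans IH; rewrite !big_ord_recr /= -addrA lerD2l /min_fun.
  rewrite mulrC -mulrDr ler_piMr ?pos_mass_le //.
  by apply: prodr_ge0 => z _; exact: pos_mass_ge0.
have m0 y : (0 <= (min_fun y)%:E)%E by rewrite lee_fin min_fun_ge0.
rewrite -nneseries_esumT //; apply: lime_le.
  exact: is_cvg_nneseries.
apply: nearW => n; rewrite big_mkord sumEFin lee_fin.
apply: le_trans (H n); rewrite lerDl.
by apply: prodr_ge0 => z _; exact: pos_mass_ge0.
Qed.

Definition sd_min : D nat := mk_subdistr min_fun_ge0 min_fun_sum.
End Minimization.

End Subdistributions.

Section ProbabilisticRecursive.
Variable R : realType.
Local Notation D := (subdistr R nat).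

(* Product of the independent g_i followed by f, that is
   (f . g)(x)(y) = sum_z (prod_i g_i(x)(z_i)) * f(z)(y), z in N^n. *)
Definition pcomp n k (f : n.-tuple nat -> D) (g : 'I_n -> k.-tuple nat -> D)
    (x : k.-tuple nat) : D :=
  sd_bind (sd_prod (fun i => g i x)) f.

Fixpoint prec_iter k (f : k.-tuple nat -> D) (g : k.+2.-tuple nat -> D)
    (x : k.-tuple nat) (y : nat) : D :=
  if y is y'.+1 then
    sd_bind (prec_iter f g x y') (fun w => g [tuple of rcons (rcons x y') w])
  else f x.

(* The recursion argument is the last component of v. *)
Definition prec k (f : k.-tuple nat -> D) (g : k.+2.-tuple nat -> D)
    (v : k.+1.-tuple nat) : D :=
  prec_iter f g [tuple tnth v (widen_ord (leqnSn k) i) | i < k]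
    (tnth v ord_max).

Definition pmin k (f : k.+1.-tuple nat -> D) (x : k.-tuple nat) : D :=
  sd_min (fun y => f [tuple of rcons x y]).

Inductive PR : forall k, (k.-tuple nat -> D) -> Prop :=
| PR_zero : PR (fun _ : 1.-tuple nat => sd_dirac R 0%N)
| PR_succ : PR (fun x : 1.-tuple nat => sd_dirac R (thead x).+1)
| PR_proj n (m : 'I_n) : PR (fun x : n.-tuple nat => sd_dirac R (tnth x m))
| PR_coin : PR (fun x : 1.-tuple nat => sd_coin R (thead x))
| PR_comp n k (f : n.-tuple nat -> D) (g : 'I_n -> k.-tuple nat -> D) :
    PR f -> (forall i, PR (g i)) -> PR (pcomp f g)
| PR_rec k (f : k.-tuple nat -> D) (g : k.+2.-tuple nat -> D) :
    PR f -> PR g -> PR (prec f g)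
| PR_min k (f : k.+1.-tuple nat -> D) : PR f -> PR (pmin f).

End ProbabilisticRecursive.

(* [f x w = None] means that f is undefined at (x, w). *)
Definition pfun (n : nat) := n.-tuple nat -> (nat -> bool) -> option nat.

(* Composition is strict: every g_i has to be defined, even if h ignores it. *)
Definition ocomp n k (h : pfun n) (g : 'I_n -> pfun k) : pfun k :=
  fun x w =>
    if [forall i, isSome (g i x w)]
    then h [tuple odflt 0%N (g i x w) | i < n] w
    else None.

Fixpoint orec_iter k (h : pfun k) (g : pfun k.+2)
    (y : nat) (x : k.-tuple nat) (w : nat -> bool) : option nat :=
  if y is y'.+1 then
    obind (fun r => g [tuple of r :: y' :: x] w) (orec_iter h g y' x w)
  else h x w.

(* The recursion argument is the first component of v. *)
Definition orec k (h : pfun k) (g : pfun k.+2) : pfun k.+1 :=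
  fun v w => orec_iter h g (thead v) [tuple of behead v] w.

(* [search_result F y]: the search for a zero of F stops at y, all the previous
   values being defined and nonzero. *)
Definition search_result (F : nat -> option nat) (y : nat) : Prop :=
  F y = Some 0%N /\ forall z, (z < y)%N -> exists k, F z = Some k.+1.

Definition search (F : nat -> option nat) : option nat :=
  if pselect (exists y, search_result F y) is left e
  then Some (sval (cid e)) else None.

Lemma searchP F y : search F = Some y <-> search_result F y.
Proof.
have uniq a b : search_result F a -> search_result F b -> (a <= b)%N.
  move=> [_ Ha] [Hb _]; rewrite leqNgt; apply/negP => /Ha[k].
  by rewrite Hb.
rewrite /search; case: pselect => [e|ne]; last first.
  by split=> // Hy; case: ne; exists y.
case: (cid e) => a Ha /=; split=> [[<-] //|Hy].
by congr Some; apply/eqP; rewrite eqn_leq !uniq.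
Qed.

Definition omin k (g : pfun k.+1) : pfun k :=
  fun x w => search (fun y => g [tuple of rcons x y] w).

Inductive OR : forall n, pfun n -> Prop :=
| OR_zero n : OR (fun (_ : n.-tuple nat) _ => Some 0%N)
| OR_succ : OR (fun (x : 1.-tuple nat) _ => Some (thead x).+1)
| OR_proj n (i : 'I_n) : OR (fun (x : n.-tuple nat) _ => Some (tnth x i))
| OR_query : OR (fun (x : 1.-tuple nat) w => Some (nat_of_bool (w (thead x))))
| OR_comp n k (h : pfun n) (g : 'I_n -> pfun k) :
    OR h -> (forall i, OR (g i)) -> OR (ocomp h g)
| OR_rec k (h : pfun k) (g : pfun k.+2) : OR h -> OR g -> OR (orec h g)
| OR_min k (g : pfun k.+1) : OR g -> OR (omin g).

Definition Q (R : realType) m (g : pfun m) (x : m.-tuple nat) (y : nat) :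
    \bar R :=
  coin_measure R [set w | g x w = Some y].

(* Main.v *)
(** A sequential sampler consumes a finite prefix of a bit stream and returns a
    value together with the number of bits it has read.  Since what it reads
    depends only on the bits already read, its accepting strings with a given
    value are prefix free, so the probability of that value is a discrete sum
    of weights 2^-|s|.  An accepting string of a sequential composition splits
    uniquely as the concatenation of an accepting string of each part; this
    makes sequential composition compute the bind of subdistributions, without
    any appeal to independence.  Every f in PR is thus the law of a sampler, and
    an oracle function runs this sampler by threading through the computation
    the position of the next unread bit, paired with the value by an arithmetic
    pairing function. *)

Require Import Defs.
From HB Require Import structures.
From mathcomp Require Import all_boot all_order all_algebra.
From mathcomp Require Import all_classical all_reals all_analysis.
From mathcomp Require Import zify.

Set Implicit Arguments.
Unset Strict Implicit.
Unset Printing Implicit Defensive.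

Import Order.TTheory GRing.Theory Num.Theory.

Local Open Scope classical_set_scope.

(** * Closure properties of oracle-recursive functions on lists of arguments *)

(* Arguments are lists rather than tuples; [h] is only constrained on lists of
   size [n]. *)
Definition ORs n (h : seq nat -> (nat -> bool) -> option nat) : Prop :=
  OR (fun x : n.-tuple nat => h x).

Definition ORt n (t : seq nat -> nat) : Prop := ORs n (fun s _ => Some (t s)).

Lemma OR_ext n (g h : pfun n) : OR g -> (forall x w, g x w = h x w) -> OR h.
Proof. by move=> Og gh; rewrite (_ : h = g) //; apply/funext=> x; apply/funext=> w. Qed.

Lemma ORs_ext n g h : ORs n g -> (forall s w, size s = n -> g s w = h s w) ->
  ORs n h.
Proof. by move=> Og gh; apply: OR_ext Og _ => x w; rewrite gh ?size_tuple. Qed.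

Lemma ORt_nth n i : (i < n)%N -> ORt n (nth 0%N ^~ i).
Proof.
move=> ltin; apply: OR_ext (OR_proj (Ordinal ltin)) _ => x w.
by rewrite (tnth_nth 0%N).
Qed.

(** The components of [sigma] are total, so the strictness test of [ocomp] always succeeds. *)
Lemma ORs_subst n k h (sigma : seq nat -> seq nat) : ORs n h ->
  (forall s, size s = k -> size (sigma s) = n) ->
  (forall i, (i < n)%N -> ORt k (fun s => nth 0%N (sigma s) i)) ->
  ORs k (fun s => h (sigma s)).
Proof.
move=> Oh size_sigma Osigma.
apply: OR_ext (OR_comp Oh (fun i : 'I_n => Osigma i (ltn_ord i))) _ => x w.
rewrite /ocomp ifT; last by apply/forallP.
congr (h _ w); apply: (@eq_from_nth _ 0%N) => [|i].
  by rewrite size_tuple size_sigma ?size_tuple.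
rewrite size_tuple => ltin; rewrite -[i]/(val (Ordinal ltin)) -tnth_nth.
by rewrite tnth_mktuple.
Qed.

(** All inner functions but the first are projections, so the strict composition fails only where
    [g] fails or where [h] fails at the value of [g]. Partial inner functions enter through this
    form. *)
Lemma ORs_let k g h : ORs k g -> ORs k.+1 h ->
  ORs k (fun s w => obind (fun a => h (a :: s) w) (g s w)).
Proof.
move=> Og Oh.
pose G (i : 'I_k.+1) : pfun k :=
  if unlift ord0 i is Some j then fun x _ => Some (tnth x j) else fun x => g x.
have OG i : OR (G i) by rewrite /G; case: unliftP => [j _|_] //; exact: OR_proj.
have G0 : G ord0 = fun x => g x by rewrite /G unlift_none.
have GS j : G (lift ord0 j) = fun x _ => Some (tnth x j) by rewrite /G liftK.
apply: OR_ext (OR_comp Oh OG) _ => x w; rewrite /ocomp.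
case gE: (g x w) => [a|]; last first.
  by rewrite ifF //; apply/forallP => /(_ ord0); rewrite G0 gE.
rewrite ifT; last first.
  apply/forallP => i; case: (unliftP ord0 i) => [j ->|->].
    by rewrite GS.
  by rewrite G0 gE.
congr (h _ w); transitivity (tval [tuple of a :: x]) => //; congr (tval _).
apply: eq_from_tnth => i; rewrite tnth_mktuple.
case: (unliftP ord0 i) => [j ->|->]; first by rewrite GS tnthS.
by rewrite G0 gE tnth0.
Qed.

Fixpoint orec_seq (h g : seq nat -> (nat -> bool) -> option nat) (y : nat)
    (s : seq nat) (w : nat -> bool) : option nat :=
  if y is y'.+1 then obind (fun r => g [:: r, y' & s] w) (orec_seq h g y' s w)
  else h s w.

Lemma ORs_rec k h g : ORs k h -> ORs k.+2 g ->
  ORs k.+1 (fun s => orec_seq h g (head 0%N s) (behead s)).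
Proof.
move=> Oh Og; apply: OR_ext (OR_rec Oh Og) _ => x w.
case/tupleP: x => y x; rewrite /orec theadE.
have -> : [tuple of behead [tuple of y :: x]] = x by exact: val_inj.
by elim: y => [//|y IH] /=; rewrite IH.
Qed.

Lemma ORs_min k g : ORs k.+1 g ->
  ORs k (fun s w => search (fun y => g (rcons s y) w)).
Proof. by move=> Og; apply: OR_ext (OR_min Og) _. Qed.

Lemma ORs_query : ORs 1 (fun s w => Some (w (head 0%N s) : nat)).
Proof.
by apply: OR_ext OR_query _ => x w; rewrite /thead (tnth_nth 0%N) nth0.
Qed.

(** * Arithmetic of total oracle-recursive functions *)

Lemma ORt_const k n : ORt k (fun=> n).
Proof.
elim: n => [|n IH]; first exact: OR_zero.
apply: (ORs_ext (g := fun s w => Some (nth 0 [:: n] 0).+1%N)) => //.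
apply: (ORs_subst (h := fun s _ => Some (nth 0 s 0).+1%N) (sigma := fun=> [:: n])).
- by apply: OR_ext OR_succ _ => x w; rewrite /thead (tnth_nth 0%N).
- by [].
- by case.
Qed.

Lemma ORt_comp1 (f : nat -> nat) k a : ORt 1 (fun s => f (nth 0%N s 0)) ->
  ORt k a -> ORt k (fun s => f (a s)).
Proof.
move=> Of Oa.
by apply: (ORs_subst (sigma := fun s => [:: a s]) Of) => // -[].
Qed.

Lemma ORt_comp2 (f : nat -> nat -> nat) k a b :
  ORt 2 (fun s => f (nth 0%N s 0) (nth 0%N s 1)) ->
  ORt k a -> ORt k b -> ORt k (fun s => f (a s) (b s)).
Proof.
move=> Of Oa Ob.
by apply: (ORs_subst (sigma := fun s => [:: a s; b s]) Of) => // -[|[]].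
Qed.

Lemma ORt_succ k a : ORt k a -> ORt k (fun s => (a s).+1).
Proof.
apply: ORt_comp1.
by apply: OR_ext OR_succ _ => x w; rewrite /thead (tnth_nth 0%N).
Qed.

(** Serves to recognise a function defined outside the scheme, such as addition, from its recursion
    equations. *)
Lemma ORt_rec k h g (f : nat -> seq nat -> nat) : ORt k h -> ORt k.+2 g ->
  (forall s, f 0%N s = h s) ->
  (forall y s, f y.+1 s = g [:: f y s, y & s]) ->
  ORt k.+1 (fun s => f (head 0%N s) (behead s)).
Proof.
move=> Oh Og f0 fS; apply: ORs_ext (ORs_rec Oh Og) _ => -[//|y s] w _ /=.
by elim: y => [|y IH] /=; rewrite ?f0 // IH /= fS.
Qed.

Lemma ORt_add k a b : ORt k a -> ORt k b -> ORt k (fun s => a s + b s)%N.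
Proof.
apply: ORt_comp2.
have := @ORt_rec 1 _ _ (fun y s => y + nth 0 s 0)%N (ORt_nth (n := 1) (i := 0) isT)
  (ORt_succ (ORt_nth (n := 3) (i := 0) isT)).
by move=> H; apply: ORs_ext (H _ _) _ => // -[|y []].
Qed.

Lemma ORt_mul k a b : ORt k a -> ORt k b -> ORt k (fun s => a s * b s)%N.
Proof.
apply: ORt_comp2.
have := @ORt_rec 1 _ _ (fun y s => y * nth 0 s 0)%N (ORt_const 1 0)
  (ORt_add (ORt_nth (n := 3) (i := 2) isT) (ORt_nth (n := 3) (i := 0) isT)).
by move=> H; apply: ORs_ext (H _ _) _ => // -[|y []].
Qed.

Lemma ORt_pred k a : ORt k a -> ORt k (fun s => (a s).-1).
Proof.
apply: ORt_comp1.
have := @ORt_rec 0 _ _ (fun y _ => y.-1) (ORt_const 0 0)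
  (ORt_nth (n := 2) (i := 1) isT).
by move=> H; apply: ORs_ext (H _ _) _ => // -[|y []].
Qed.

Lemma ORt_sub k a b : ORt k a -> ORt k b -> ORt k (fun s => a s - b s)%N.
Proof.
(* The recursion runs on the subtrahend, which must come first; hence the swap. *)
move=> Oa Ob; apply: (ORt_comp2 (f := fun y x => x - y)%N) Ob Oa.
have := @ORt_rec 1 _ _ (fun y s => nth 0 s 0 - y)%N (ORt_nth (n := 1) (i := 0) isT)
  (ORt_pred (ORt_nth (n := 3) (i := 0) isT)).
move=> H; apply: ORs_ext (H _ _) _ => [s|y s|[|y []]] //; first by rewrite subn0.
by rewrite subnS.
Qed.

(** * Integer square root and pairing *)

(** The floor of the square root. The truncated subtraction is 1 when the next square is at most
    [c'.+1] and 0 otherwise, so the step uses only sums, products and differences. *)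
Fixpoint isqrt (c : nat) : nat :=
  if c is c'.+1 then (isqrt c' + (1 - ((isqrt c').+1 * (isqrt c').+1 - c'.+1)))%N
  else 0%N.

Lemma isqrt_bounds c : (isqrt c * isqrt c <= c < (isqrt c).+1 * (isqrt c).+1)%N.
Proof.
elim: c => [//|c] /=; set r := isqrt c => IH.
by case: (leqP (r.+1 * r.+1)%N c.+1) => H; nia.
Qed.

Lemma isqrt_uniq c r : (r * r <= c < r.+1 * r.+1)%N -> isqrt c = r.
Proof. by have := isqrt_bounds c; nia. Qed.

Lemma ORt_isqrt k a : ORt k a -> ORt k (fun s => isqrt (a s)).
Proof.
apply: ORt_comp1.
have Or : ORt 2 (nth 0%N ^~ 0%N) by exact: ORt_nth.
have Oc : ORt 2 (nth 0%N ^~ 1%N) by exact: ORt_nth.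
have := @ORt_rec 0 _ _ (fun y _ => isqrt y) (ORt_const 0 0)
  (ORt_add Or (ORt_sub (ORt_const 2 1)
    (ORt_sub (ORt_mul (ORt_succ Or) (ORt_succ Or)) (ORt_succ Oc)))).
by move=> H; apply: ORs_ext (H _ _) _ => // -[|y []].
Qed.

(** Since [a <= a + b], the code lies between the squares of [a + b] and [a + b + 1], so its integer
    square root is [a + b]. Unlike in Cantor's pairing, no halving occurs. *)
Definition pair_code (a b : nat) : nat := ((a + b) * (a + b) + a)%N.
Definition code_fst (c : nat) : nat := (c - isqrt c * isqrt c)%N.
Definition code_snd (c : nat) : nat := (isqrt c - code_fst c)%N.

Lemma isqrt_pair_code a b : isqrt (pair_code a b) = (a + b)%N.
Proof. by apply: isqrt_uniq; rewrite /pair_code; nia. Qed.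

Lemma pair_codeK1 a b : code_fst (pair_code a b) = a.
Proof. by rewrite /code_fst isqrt_pair_code addKn. Qed.

Lemma pair_codeK2 a b : code_snd (pair_code a b) = b.
Proof. by rewrite /code_snd pair_codeK1 isqrt_pair_code addKn. Qed.

Lemma ORt_pair k a b : ORt k a -> ORt k b -> ORt k (fun s => pair_code (a s) (b s)).
Proof. by move=> Oa Ob; do !apply: ORt_add || apply: ORt_mul. Qed.

Lemma ORt_fst k a : ORt k a -> ORt k (fun s => code_fst (a s)).
Proof.
by move=> Oa; apply: ORt_sub => //; apply: ORt_mul; exact: ORt_isqrt.
Qed.

Lemma ORt_snd k a : ORt k a -> ORt k (fun s => code_snd (a s)).
Proof. by move=> Oa; apply: ORt_sub; [exact: ORt_isqrt|exact: ORt_fst]. Qed.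

(** * Lists of total functions, used as simultaneous substitutions *)

Definition ORl n k (sigma : seq nat -> seq nat) : Prop :=
  (forall s, size s = k -> size (sigma s) = n) /\
  (forall i, (i < n)%N -> ORt k (fun s => nth 0%N (sigma s) i)).

Lemma ORl_id k : ORl k k id.
Proof. by split=> // i; exact: ORt_nth. Qed.

Lemma ORl_nil k : ORl 0 k (fun=> [::]).
Proof. by []. Qed.

Lemma ORl_cons n k t sigma : ORt k t -> ORl n k sigma ->
  ORl n.+1 k (fun s => t s :: sigma s).
Proof.
move=> Ot [sz Os]; split=> [s /sz /= -> //|[|i] //= ltin].
exact: Os.
Qed.

Lemma ORl_cat m n k sigma tau : ORl m k sigma -> ORl n k tau ->
  ORl (m + n) k (fun s => sigma s ++ tau s).
Proof.
move=> [szs Os] [szt Ot]; split=> [s sk|i lti].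
  by rewrite size_cat szs ?szt.
have [ltim|leim] := ltnP i m.
  by apply: ORs_ext (Os i ltim) _ => s w sk; rewrite nth_cat szs // ltim.
apply: ORs_ext (Ot (i - m)%N _) _ => [|s w sk]; first by rewrite ltn_subLR.
by rewrite nth_cat szs // ltnNge leim.
Qed.

Lemma ORl_rcons n k t sigma : ORl n k sigma -> ORt k t ->
  ORl n.+1 k (fun s => rcons (sigma s) (t s)).
Proof.
move=> Os Ot; have := ORl_cat Os (ORl_cons Ot (ORl_nil k)).
by rewrite addn1; under eq_fun do rewrite cats1.
Qed.

Lemma ORl_take m n k sigma : (m <= n)%N -> ORl n k sigma ->
  ORl m k (fun s => take m (sigma s)).
Proof.
move=> lemn [sz Os]; split=> [s sk|i ltim].
  by rewrite size_take_min sz //; apply/minn_idPl.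
apply: ORs_ext (Os i (leq_trans ltim lemn)) _ => s w sk.
by rewrite nth_take.
Qed.

Lemma ORl_drop m n k sigma : ORl (m + n) k sigma ->
  ORl n k (fun s => drop m (sigma s)).
Proof.
move=> [sz Os]; split=> [s sk|i ltin]; first by rewrite size_drop sz // addKn.
apply: ORs_ext (Os (m + i)%N _) _ => [|s w sk]; first by rewrite ltn_add2l.
by rewrite nth_drop.
Qed.

Lemma ORl_rev n k sigma : ORl n k sigma -> ORl n k (fun s => rev (sigma s)).
Proof.
move=> [sz Os]; split=> [s sk|i ltin]; first by rewrite size_rev sz.
apply: ORs_ext (Os (n - i.+1)%N _) _ => [|s w sk].
  by rewrite -subn_gt0 subKn.
by rewrite nth_rev sz.
Qed.

Lemma ORs_substl n k h sigma : ORs n h -> ORl n k sigma ->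
  ORs k (fun s => h (sigma s)).
Proof. by move=> Oh [sz Os]; exact: ORs_subst Oh sz Os. Qed.

(** * Samplers and their combinators *)

Definition sampler := (nat -> bool) -> option (nat * nat).

Definition stream_drop (n : nat) (w : nat -> bool) : nat -> bool :=
  fun i => w (n + i)%N.

Lemma stream_dropD m n w :
  stream_drop n (stream_drop m w) = stream_drop (m + n) w.
Proof. by apply/funext => i; rewrite /stream_drop addnA. Qed.

Definition sret (a : nat) : sampler := fun _ => Some (a, 0%N).

Definition sbind (M : sampler) (K : nat -> sampler) : sampler := fun w =>
  if M w is Some (a, n) then
    omap (fun r => (r.1, n + r.2)%N) (K a (stream_drop n w))
  else None.

Definition scoin (x : nat) : sampler := fun w => Some (x + w 0, 1)%N.

(** The [g i] read consecutive segments of the stream, and [f] reads on after them. *)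
Fixpoint scomp n : ('I_n -> sampler) -> (seq nat -> sampler) -> sampler :=
  if n is n'.+1 then fun g f =>
    sbind (g ord0)
      (fun a => scomp (fun i : 'I_n' => g (lift ord0 i)) (fun z => f (a :: z)))
  else fun _ f => f [::].

Fixpoint srec (F G : seq nat -> sampler) (y : nat) (x : seq nat) : sampler :=
  if y is y'.+1 then
    sbind (srec F G y' x) (fun a => G (rcons (rcons x y') a))
  else F x.

Fixpoint siter (F : nat -> sampler) (y : nat) : sampler :=
  if y is y'.+1 then sbind (siter F y') (fun=> F y') else sret 0.

(* [siter F y] keeps only the value of its last run [F y.-1], the one that the
   search tests. *)
Definition smin (F : nat -> sampler) : sampler := fun w =>
  obind (fun y => omap (fun r => (y, r.2)) (siter F y.+1 w))
    (search (fun y => omap fst (siter F y.+1 w))).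

(** * Realizing samplers by oracle functions that thread the reading position *)

(* The first argument is the position of the next unread bit. *)
Definition realizer (M : seq nat -> sampler) (s : seq nat) (w : nat -> bool) :
    option nat :=
  omap (fun r => pair_code r.1 (head 0%N s + r.2))
    (M (behead s) (stream_drop (head 0%N s) w)).

Definition realizable k (M : seq nat -> sampler) : Prop := ORs k.+1 (realizer M).

Lemma realizable_ext k M N : realizable k M ->
  (forall x, size x = k -> M x = N x) -> realizable k N.
Proof.
move=> rM MN; apply: ORs_ext rM _ => -[//|p x] w [/MN xk].
by rewrite /realizer /= xk.
Qed.

Lemma ORl_behead k : ORl k k.+1 behead.
Proof.
have /= := @ORl_drop 1 k k.+1 id (ORl_id _).
by under eq_fun do rewrite drop1.
Qed.

Lemma realizable_subst n k M sigma : realizable n M -> ORl n k sigma ->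
  realizable k (fun x => M (sigma x)).
Proof.
move=> rM [sz Os].
(* The head, which holds the position, is kept while [sigma] acts on the rest. *)
have O1 : ORl n.+1 k.+1 (fun s => nth 0%N s 0 :: sigma (behead s)).
  apply: ORl_cons; first exact: ORt_nth.
  split=> [[//|p s] [/sz]//|i ltin].
  exact: ORs_substl (Os i ltin) (ORl_behead k).
by apply: ORs_ext (ORs_substl rM O1) _ => -[].
Qed.

Lemma realizable_ret k t : ORt k t -> realizable k (fun x => sret (t x)).
Proof.
move=> Ot; have := ORt_pair (ORs_substl Ot (ORl_behead k)) (@ORt_nth k.+1 0 isT).
by move=> H; apply: ORs_ext H _ => -[//|p x] w _; rewrite /realizer /= addn0.
Qed.

Lemma realizable_coin : realizable 1 (fun x => scoin (head 0%N x)).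
Proof.
have O3 i : (i < 3)%N -> ORt 3 (nth 0%N ^~ i) by exact: ORt_nth.
have := ORs_let (ORs_substl ORs_query (@ORl_take 1 2 2 id isT (ORl_id 2)))
  (ORt_pair (ORt_add (O3 2 isT) (O3 0 isT)) (ORt_succ (O3 1 isT))).
move=> H; apply: ORs_ext H _ => -[//|p [//|x s]] w _ /=.
by rewrite /realizer /= /stream_drop addn0 addn1.
Qed.

Lemma realizable_bind k M K : realizable k M -> realizable k.+1 K ->
  realizable k (fun x => sbind (M x) (fun a => K (a :: x))).
Proof.
move=> rM rK.
(* Here [s] lists the code produced by [M], the old position and [x]; [K] is run on the new
   position, the sampled value and [x]. *)
have O1 : ORl k.+2 k.+2 (fun s => code_snd (nth 0%N s 0) ::
    code_fst (nth 0%N s 0) :: drop 2 s).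
  apply: ORl_cons; first by apply: ORt_snd; exact: ORt_nth.
  apply: ORl_cons; first by apply: ORt_fst; exact: ORt_nth.
  exact: (@ORl_drop 2 k k.+2 id (ORl_id _)).
apply: ORs_ext (ORs_let rM (ORs_substl rK O1)) _ => -[//|p x] w _.
rewrite /realizer /= /sbind; case: (M x _) => [[a n]|] //=.
rewrite drop0 pair_codeK1 pair_codeK2 stream_dropD.
by case: (K _ _) => [[b m]|] //=; rewrite addnA.
Qed.

(* The first [j] entries of [e] are the samples drawn so far, latest first. *)
Lemma realizable_comp n k j (g : 'I_n -> seq nat -> sampler) f :
  (forall i, realizable k (g i)) -> realizable (j + n) f ->
  realizable (j + k) (fun e =>
    scomp (fun i => g i (drop j e)) (fun z => f (rev (take j e) ++ z))).
Proof.
elim: n j g f => [|n IH] j g f rg rf.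
  rewrite addn0 in rf; apply: realizable_subst rf _.
  under eq_fun do rewrite cats0.
  by apply: ORl_rev; apply: ORl_take (ORl_id _); exact: leq_addr.
rewrite -addSnnS in rf.
(* The sample of [g ord0] becomes the new head of [e], whence [j.+1] in the induction hypothesis. *)
have := realizable_bind
  (realizable_subst (rg ord0) (ORl_drop (ORl_id (j + k))))
  (IH j.+1 (fun i => g (lift ord0 i)) f (fun i => rg _) rf).
move=> H; apply: realizable_ext H _ => e _ /=; congr sbind.
apply/funext => a; congr scomp; apply/funext => z.
by rewrite rev_cons cat_rcons.
Qed.

Lemma realizable_rec k F G : realizable k F -> realizable k.+2 G ->
  realizable k.+1 (fun v => srec F G (nth 0%N v k) (take k v)).
Proof.
move=> rF rG.
(* The recursion scheme supplies the code of the previous result, the index, the starting position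
   and [x]; [G] expects the current position, [x], the index and the previous value. *)
have O1 : ORl k.+3 k.+3 (fun s => code_snd (nth 0%N s 0) ::
    rcons (rcons (drop 3 s) (nth 0%N s 1)) (code_fst (nth 0%N s 0))).
  apply: ORl_cons; first by apply: ORt_snd; exact: ORt_nth.
  apply: ORl_rcons; last by apply: ORt_fst; exact: ORt_nth.
  apply: ORl_rcons; last exact: ORt_nth.
  exact: (@ORl_drop 3 k k.+3 id (ORl_id _)).
(* The index is the last argument for [prec] but the first for [orec]. *)
have O2 : ORl k.+2 k.+2 (fun s => nth 0%N s k.+1 :: take k.+1 s).
  by apply: ORl_cons; [exact: ORt_nth|apply: ORl_take (ORl_id _)].
have H := ORs_substl (ORs_rec rF (ORs_substl rG O1)) O2.
apply: ORs_ext H _ => -[//|p v] w _.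
rewrite [RHS]/realizer /=; elim: (nth _ _ _) => [//|y IH] /=;
  rewrite IH /realizer /= /sbind.
case: (srec F G y _ _) => [[a n]|] //=.
rewrite drop0 pair_codeK1 pair_codeK2 stream_dropD.
by case: (G _ _) => [[b m]|] //=; rewrite addnA.
Qed.

(** A recursion whose step forgets the previous value, removed by [take k.+1]. *)
Lemma realizable_iter k M : realizable k.+1 M ->
  realizable k.+1 (fun v => siter (fun z => M (rcons (take k v) z)) (nth 0%N v k)).
Proof.
move=> rM.
have rM2 : realizable k.+2 (fun v => M (take k.+1 v)).
  by apply: realizable_subst rM _; apply: ORl_take (ORl_id _).
have H := realizable_rec (realizable_ret (ORt_const k 0)) rM2.
apply: realizable_ext H _ => v vk.
have tk : size (take k v) = k by rewrite size_take_min vk; apply/minn_idPl.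
elim: (nth _ _ _) => [//|y IH] /=; rewrite IH; congr sbind; apply/funext => a.
by rewrite -cats1 take_size_cat // size_rcons tk.
Qed.

(** The search passes no state from one candidate to the next, so each test replays all runs from
    the starting position, and a given run reads the same bits in every test. Once [y] is found, one
    more replay yields the position reached. *)
Lemma realizable_min k M : realizable k.+1 M ->
  realizable k (fun x => smin (fun z => M (rcons x z))).
Proof.
move=> rM; have rT := realizable_iter rM.
set T := (fun v => siter _ _) in rT.
have TE p x y w : size x = k -> realizer T (p :: rcons x y) w =
    omap (fun r => pair_code r.1 (p + r.2))
      (siter (fun z => M (rcons x z)) y (stream_drop p w)).
  move=> xk; rewrite /realizer /= /T.
  by rewrite -cats1 take_size_cat // nth_cat xk ltnn subnn.
(* Testing the candidate [y] takes the [y.+1] runs at [0, ..., y]. *)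
have O1 : ORl k.+2 k.+2 (fun s => rcons (take k.+1 s) (nth 0%N s k.+1).+1).
  apply: ORl_rcons; first exact: ORl_take (ORl_id _).
  by apply: ORt_succ; exact: ORt_nth.
have O2 : ORl k.+2 k.+2
    (fun s => nth 0%N s 1 :: rcons (drop 2 s) (nth 0%N s 0).+1).
  apply: ORl_cons; first exact: ORt_nth.
  apply: ORl_rcons; last by apply: ORt_succ; exact: ORt_nth.
  exact: (@ORl_drop 2 k k.+2 id (ORl_id _)).
(* [Hval] is the value tested by the search; [Hpos] pairs the [y] found with the position after the
   replay. *)
have Hval := ORs_let (ORs_substl rT O1)
  (ORt_fst (@ORt_nth k.+3 0 isT)).
have Hpos := ORs_let (ORs_substl rT O2)
  (ORt_pair (@ORt_nth k.+3 1 isT) (ORt_snd (@ORt_nth k.+3 0 isT))).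
apply: ORs_ext (ORs_let (ORs_min Hval) Hpos) _ => -[//|p x] w [xk] /=.
rewrite [RHS]/realizer /= /smin.
set F := fun z => M (rcons x z); set w' := stream_drop p w.
rewrite (_ : search (fun y => obind _ _) =
    search (fun y => omap fst (siter F y.+1 w'))).
  case: (search _) => [y|] //; rewrite /obind/oapp.
  rewrite drop0 TE // -/F -/w'.
  by case: (siter F y.+1 w') => [[b m]|] //=; rewrite pair_codeK2.
congr search; apply/funext => y.
have -> : take k (rcons x y) = x by rewrite -cats1 take_size_cat.
rewrite nth_rcons xk ltnn eqxx TE // -/F -/w'.
by case: (siter F y.+1 w') => [[b m]|] //=; rewrite pair_codeK1.
Qed.

(** * Locality and accepting strings *)

Definition local (M : sampler) : Prop := forall w w' r,
  M w = Some r -> (forall i, (i < r.2)%N -> w i = w' i) -> M w' = Some r.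

Lemma local_ret a : local (sret a).
Proof. by move=> w w' r [<-]. Qed.

Lemma local_coin x : local (scoin x).
Proof. by move=> w w' r [<-] /= ww'; rewrite /scoin ww'. Qed.

Lemma sbind_SomeE M (K : nat -> sampler) w y n : sbind M K w = Some (y, n) <->
  exists a n1 n2, [/\ M w = Some (a, n1),
    K a (stream_drop n1 w) = Some (y, n2) & n = (n1 + n2)%N].
Proof.
rewrite /sbind; split=> [|[a [n1 [n2 [-> -> ->]]]] //].
case: (M w) => [[a n1]|] //.
by case Kw: (K _ _) => [[b n2]|] //= [<- <-]; exists a, n1, n2.
Qed.

Lemma local_bind M (K : nat -> sampler) :
  local M -> (forall a, local (K a)) -> local (sbind M K).
Proof.
move=> lM lK w w' [y n] /sbind_SomeE[a [n1 [n2 [Mw Kw ->]]]] /= ww'.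
apply/sbind_SomeE; exists a, n1, n2; split=> //.
  by apply: lM Mw _ => i /= lti; rewrite ww' // ltn_addr.
by apply: lK Kw _ => i /= lti; rewrite /stream_drop ww' // ltn_add2l.
Qed.

(* [s] is an accepting string of [M] with value [a]: on input [s], padded with
   zeros, [M] returns [a] and reads exactly the bits of [s]. *)
Definition accepts (M : sampler) (a : nat) : set (seq bool) :=
  [set s | M (nth false s) = Some (a, size s)].

Lemma accepts_cylinder M a s w : local M -> accepts M a s -> cylinder s w ->
  M w = Some (a, size s).
Proof. by move=> lM Ms sw; apply: lM Ms _ => i /sw. Qed.

Lemma accepts_mkseq M a n w : local M -> M w = Some (a, n) ->
  accepts M a (mkseq w n).
Proof.
move=> lM Mw; rewrite /accepts /= size_mkseq; apply: lM Mw _ => i /= ltin.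
by rewrite nth_mkseq.
Qed.

Lemma cylinder_mkseq n (w : nat -> bool) : cylinder (mkseq w n) w.
Proof. by move=> i; rewrite size_mkseq => ltin; rewrite nth_mkseq. Qed.

(** * Discrete output probabilities, and samplers of given subdistributions *)

Section Probability.
Variable R : realType.
Implicit Types (M : sampler) (s : seq bool).

Local Open Scope ring_scope.
Local Open Scope ereal_scope.

Definition weight s : R := (2^-1 ^+ size s)%R.

Lemma weight_ge0 s : (0 <= weight s)%R.
Proof. by rewrite exprn_ge0 // invr_ge0. Qed.

Lemma weight_cat s t : weight (s ++ t) = (weight s * weight t)%R.
Proof. by rewrite /weight size_cat exprD. Qed.

(** For local [M] this is the probability of the value [a], by [coin_measure_sampler]; until then,
    no measure is involved. *)
Definition spr M (a : nat) : \bar R := \esum_(s in accepts M a) (weight s)%:E.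

Lemma spr_ge0 M a : 0 <= spr M a.
Proof. by apply: esum_ge0 => s _; rewrite lee_fin weight_ge0. Qed.

Lemma esumZl (T : choiceType) (D : set T) (c : R) (a : T -> \bar R) :
  (0 <= c)%R -> (forall t, 0 <= a t) ->
  \esum_(t in D) (c%:E * a t) = c%:E * \esum_(t in D) a t.
Proof.
move=> c0 a0; rewrite /esum -ereal_supZl //; last first.
  apply/set0P; exists (\sum_(x \in set0) a x); exists set0 => //.
  by split=> //; exact: sub0set.
congr ereal_sup; rewrite image_comp; apply: eq_imagel => A _ /=.
by rewrite -ge0_mule_fsumr.
Qed.

Lemma esumZr (T : choiceType) (D : set T) (c : R) (a : T -> \bar R) :
  (0 <= c)%R -> (forall t, 0 <= a t) ->
  \esum_(t in D) (a t * c%:E) = (\esum_(t in D) a t) * c%:E.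
Proof.
by move=> c0 a0; rewrite muleC -esumZl //; apply: eq_esum => t _; exact: muleC.
Qed.

(** Weights multiply under concatenation, so the sum over pairs of strings factors. The values of
    [q] are real, hence finite, so that they can leave the sum. *)
Lemma spr_bind M (K : nat -> sampler) (q : nat -> R) y :
  local M -> (forall a, local (K a)) ->
  (forall a, spr (K a) y = (q a)%:E) ->
  spr (sbind M K) y = \esum_(a in [set: nat]) (spr M a * (q a)%:E).
Proof.
move=> lM lK Kq.
have q0 a : (0 <= q a)%R by rewrite -lee_fin -Kq spr_ge0.
transitivity (\esum_(a in [set: nat])
    \esum_(u in accepts M a `*`` fun=> accepts (K a) y) (weight (u.1 ++ u.2))%:E).
  rewrite esum_esum => [|? ? _ _]; last by rewrite lee_fin weight_ge0.
  rewrite /spr (reindex_esum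
    ([set: nat] `*`` fun a => accepts M a `*`` fun=> accepts (K a) y)
    _ (fun v => v.2.1 ++ v.2.2)) //.
  (* By locality, [M] still accepts [s1] when the zero padding is preceded by [s2]. *)
  have run a s1 s2 : accepts M a s1 -> M (nth false (s1 ++ s2)) = Some (a, size s1).
    by move=> Ms1; apply: accepts_cylinder Ms1 _ => // i lti; rewrite nth_cat lti.
  have drop_cat s1 s2 : stream_drop (size s1) (nth false (s1 ++ s2)) = nth false s2.
    apply/funext => i.
    by rewrite /stream_drop nth_cat ltnNge leq_addr /= addKn.
  split=> [[a [s1 s2]] [_ [/= Ms1 Ks2]]||s /sbind_SomeE[a [n1 [n2 [Ms Ks ns]]]]].
  - apply/sbind_SomeE; exists a, (size s1), (size s2).
    by rewrite (run a) // drop_cat size_cat.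
  (* Injectivity: running [M] on the common string reveals both the value and the length of the
     first part. *)
  - move=> [a [s1 s2]] [a' [s1' s2']].
    rewrite !inE => -[_ [/= Ms1 _]] [_ [/= Ms1' _]] E.
    have := run _ _ s2 Ms1; rewrite E (run a') // => -[-> sz].
    have /eqP := E; rewrite eqseq_cat // => /andP[/eqP -> /eqP ->] //.
  (* Surjectivity: [s] is cut after the [n1] bits that [M] reads. *)
  have sE : s = mkseq (nth false s) n1 ++ drop n1 s.
    apply: (@eq_from_nth _ false) => [|i _].
      by rewrite size_cat size_mkseq size_drop subnKC // ns leq_addr.
    rewrite nth_cat size_mkseq; case: ltnP => [lti|lei]; first by rewrite nth_mkseq.
    by rewrite nth_drop subnKC.
  exists (a, (mkseq (nth false s) n1, drop n1 s)) => //.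
  split=> //=; split=> /=; first exact: accepts_mkseq.
  rewrite /accepts /= size_drop ns addKn -Ks; congr K.
  by apply/funext => i; rewrite nth_drop.
apply: eq_esum => a _.
rewrite -(esum_esum (a := fun s1 s2 => (weight (s1 ++ s2))%:E)); last first.
  by move=> ? ? _ _; rewrite lee_fin weight_ge0.
rewrite -esumZr //; last by move=> s; rewrite lee_fin weight_ge0.
apply: eq_esum => s1 _; rewrite -Kq -esumZl ?weight_ge0 //; last first.
  by move=> s; rewrite lee_fin weight_ge0.
by apply: eq_esum => s2 _; rewrite weight_cat EFinM.
Qed.

Lemma spr_ret a y : spr (sret a) y = (y == a)%:R%:E.
Proof.
rewrite /spr; case: eqVneq => [->|ya].
  rewrite (_ : accepts _ _ = [set [::]]).
    by rewrite esum_set1 ?lee_fin ?weight_ge0 // /weight expr0.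
  by apply/seteqP; split=> s /= => [[/esym/size0nil]|->].
rewrite (_ : accepts _ _ = set0) ?esum_set0 //.
by apply/seteqP; split=> s //= [/eqP]; rewrite eq_sym (negbTE ya).
Qed.

Lemma spr_coin x y : spr (scoin x) y = (coin_fun R x y)%:E.
Proof.
have acceptsE (b : bool) : accepts (scoin x) (x + b)%N = [set [:: b]].
  apply/seteqP; split=> s /=; last by move=> ->.
  rewrite /accepts /scoin /= => -[/addnI E /esym sz].
  by case: s sz E => [|c []] //= _; case: b c => -[].
rewrite /coin_fun; have [->|yx] := eqVneq y x.
  have := acceptsE false; rewrite addn0 /spr => ->.
  by rewrite esum_set1 ?lee_fin ?weight_ge0 // /weight expr1 div1r.
have [->|yx1] := eqVneq y x.+1.
  have := acceptsE true; rewrite addn1 /spr => ->.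
  by rewrite esum_set1 ?lee_fin ?weight_ge0 // /weight expr1 div1r.
rewrite /spr (_ : accepts _ _ = set0) ?esum_set0 //.
apply/seteqP; split=> s //= -[E _].
by move: E yx yx1; case: (nth _ _ _) => <-; rewrite ?addn0 ?addn1 eqxx.
Qed.

Definition samples M (d : subdistr R nat) : Prop :=
  local M /\ forall y, spr M y = (d y)%:E.

Lemma samples_ret a : samples (sret a) (sd_dirac R a).
Proof. by split=> [|y]; [exact: local_ret|exact: spr_ret]. Qed.

Lemma samples_coin x : samples (scoin x) (sd_coin R x).
Proof. by split=> [|y]; [exact: local_coin|exact: spr_coin]. Qed.

Lemma samples_bind M (K : nat -> sampler) d k :
  samples M d -> (forall a, samples (K a) (k a)) ->
  samples (sbind M K) (sd_bind d k).
Proof.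
move=> [lM Md] Kk; split=> [|y].
  by apply: local_bind => // a; have [] := Kk a.
rewrite (spr_bind (q := fun a => k a y)) //; last 2 first.
- by move=> a; have [] := Kk a.
- by move=> a; have [_ ->] := Kk a.
by rewrite [RHS]bind_fun_fin; apply: eq_esum => a _; rewrite Md.
Qed.

Lemma samples_ext M (d e : subdistr R nat) : samples M d ->
  (forall y, d y = e y) -> samples M e.
Proof. by move=> [lM Md] de; split=> // y; rewrite Md de. Qed.

(** Splitting a tuple into head and tail makes the sum an iterated one and detaches the first factor
    of the product, as [scomp] does when it draws the first sample. *)
Lemma sd_bind_prodS n (p : 'I_n.+1 -> subdistr R nat)
    (k : n.+1.-tuple nat -> subdistr R nat) y :
  sd_bind (p ord0) (fun a =>
    sd_bind (sd_prod (fun i => p (lift ord0 i))) (fun z => k [tuple of a :: z])) y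
  = sd_bind (sd_prod p) k y.
Proof.
apply: EFin_inj; rewrite [LHS]bind_fun_fin [RHS]bind_fun_fin.
set tl := sd_prod (fun i => p (lift ord0 i)).
rewrite [RHS](reindex_esum ([set: nat] `*`` fun=> [set: n.-tuple nat]) _
  (fun u => [tuple of u.1 :: u.2])); last first.
  split=> [//|[a z] [a' z'] _ _ /(congr1 val) [-> /val_inj -> //]|z _].
  by exists (thead z, [tuple of behead z]) => //=; rewrite -tuple_eta.
have pk0 a z : 0 <= (p ord0 a * (tl z * k [tuple of a :: z] y))%:E.
  by rewrite lee_fin !mulr_ge0 ?sd_ge0.
rewrite (eq_esum (b := fun u =>
  (p ord0 u.1 * (tl u.2 * k [tuple of u.1 :: u.2] y))%:E)); last first.
  move=> [a z] _ /=; rewrite /prod_fun big_ord_recl tnth0 -mulrA.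
  by under eq_bigr do rewrite tnthS.
rewrite -(esum_esum (a := fun a z =>
  (p ord0 a * (tl z * k [tuple of a :: z] y))%:E)) => [|a z _ _]; last exact: pk0.
apply: eq_esum => a _; rewrite EFinM [X in _ * X]bind_fun_fin -esumZl ?sd_ge0 //.
by move=> z; rewrite lee_fin mulr_ge0 ?sd_ge0.
Qed.

Lemma samples_comp n (g : 'I_n -> sampler) (f : seq nat -> sampler) p
    (k : n.-tuple nat -> subdistr R nat) :
  (forall i, samples (g i) (p i)) -> (forall z : n.-tuple nat, samples (f z) (k z)) ->
  samples (scomp g f) (sd_bind (sd_prod p) k).
Proof.
elim: n g f p k => [|n IH] g f p k gp fk.
  apply: samples_ext (fk [tuple]) _ => y.
  apply: EFin_inj; rewrite [RHS]bind_fun_fin.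
  rewrite (_ : [set: 0.-tuple nat] = [set [tuple]]); last first.
    by apply/seteqP; split=> z //= _; rewrite tuple0.
  rewrite esum_set1 ?lee_fin ?mulr_ge0 ?sd_ge0 //.
  by rewrite /= /prod_fun big_ord0 mul1r.
have H := samples_bind (gp ord0) (fun a =>
  IH _ (fun z => f (a :: z)) _ _ (fun i => gp (lift ord0 i))
    (fun z => fk [tuple of a :: z])).
by apply: samples_ext H _ => y; exact: sd_bind_prodS.
Qed.

Lemma samples_rec k (F G : seq nat -> sampler) (f : k.-tuple nat -> subdistr R nat)
    (g : k.+2.-tuple nat -> subdistr R nat) y (x : k.-tuple nat) :
  (forall x : k.-tuple nat, samples (F x) (f x)) ->
  (forall v : k.+2.-tuple nat, samples (G v) (g v)) ->
  samples (srec F G y x) (prec_iter f g x y).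
Proof.
move=> Ff Gg; elim: y => [|y IH] /=; first exact: Ff.
by apply: samples_bind IH _ => a; exact: (Gg [tuple of rcons (rcons x y) a]).
Qed.

End Probability.

(** * Minimization: reaching a candidate, and the law of the search *)

Definition spos (M : sampler) : sampler := fun w =>
  if M w is Some (a.+1, n) then Some (a.+1, n) else None.

(* Unlike [siter], fails at the first zero: it succeeds exactly when the
   minimization reaches [y]. *)
Fixpoint siter_pos (F : nat -> sampler) (y : nat) : sampler :=
  if y is y'.+1 then sbind (siter_pos F y') (fun=> spos (F y')) else sret 0.

Lemma spos_SomeE M w a n :
  spos M w = Some (a, n) <-> M w = Some (a, n) /\ (0 < a)%N.
Proof.
rewrite /spos; split; last by case=> -> /=; case: a.
by case: (M w) => [[[|b] m]|] // [<- <-].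
Qed.

Lemma local_pos M : local M -> local (spos M).
Proof.
move=> lM w w' [a n] /spos_SomeE[Mw a0] ww'; apply/spos_SomeE; split=> //.
exact: lM Mw ww'.
Qed.

Lemma local_iter_pos (F : nat -> sampler) y :
  (forall z, local (F z)) -> local (siter_pos F y).
Proof.
move=> lF; elim: y => [|y IH] /=; first exact: local_ret.
by apply: local_bind => // _; exact: local_pos.
Qed.

Lemma siter_pos_SomeE (F : nat -> sampler) y w a n :
  siter_pos F y w = Some (a, n) <-> siter F y w = Some (a, n) /\
  forall z, (z < y)%N -> exists k m, siter F z.+1 w = Some (k.+1, m).
Proof.
elim: y a n => [|y IH] a n; first by split=> [|[]].
split=> [/sbind_SomeE[b [n1 [n2 [/IH[Fw prev] /spos_SomeE[Fy a0] ->]]]]|].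
  have Fw' : siter F y.+1 w = Some (a, n1 + n2)%N.
    by apply/sbind_SomeE; exists b, n1, n2.
  split=> // z; rewrite ltnS leq_eqVlt => /predU1P[->|/prev//].
  by exists a.-1, (n1 + n2)%N; rewrite prednK.
case=> Fw prev; have /sbind_SomeE[b [n1 [n2 [Fy Fw' nE]]]] := Fw.
apply/sbind_SomeE; exists b, n1, n2; split=> //.
  by apply/IH; split=> // z zy; apply: prev; exact: ltnW.
apply/spos_SomeE; split=> //.
by have [k [m]] := prev y (ltnSn y); rewrite Fw => -[-> _].
Qed.

(** Turns the unbounded search into a finite sequential composition, to which [local_bind] and
    [spr_bind] apply. *)
Lemma smin_SomeE (F : nat -> sampler) w y n : smin F w = Some (y, n) <->
  sbind (siter_pos F y) (fun=> F y) w = Some (0%N, n).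
Proof.
set T := fun y => omap fst (siter F y.+1 w).
have prevE z : (exists k, T z = Some k.+1) <->
    (exists k m, siter F z.+1 w = Some (k.+1, m)).
  rewrite /T; case: (siter F z.+1 w) => [[a m]|].
    by split=> [[k /= [->]]|[k [_ [-> _]]]]; exists k => //; exists m.
  by split=> [[]|[? []]].
have -> : smin F w = Some (y, n) <->
    search_result T y /\ siter F y.+1 w = Some (0%N, n).
  rewrite /smin -/T -searchP; split=> [|[-> /= ->] //].
  case E: (search T) => [z|] //=.
  case Fw: (sbind _ _ _) => [[a m]|] //= [zy mn]; subst z m; split=> //.
  by move/searchP: E => [+ _]; rewrite /T /= Fw => -[->].
split=> [[[_ prev] /sbind_SomeE[b [n1 [n2 [Fw Fy nE]]]]]|].
  apply/sbind_SomeE; exists b, n1, n2; split=> //.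
  by apply/siter_pos_SomeE; split=> // z /prev/prevE.
move=> /sbind_SomeE[b [n1 [n2 [/siter_pos_SomeE[Fw prev] Fy nE]]]].
have Fw' : siter F y.+1 w = Some (0%N, n) by apply/sbind_SomeE; exists b, n1, n2.
by do !split=> //; [rewrite /T Fw'|move=> z /prev/prevE].
Qed.

Section Minimization.
Variable R : realType.
Local Open Scope ring_scope.
Local Open Scope ereal_scope.

Lemma spr_pos M a : spr R (spos M) a = if (0 < a)%N then spr R M a else 0.
Proof.
rewrite /spr; case: ifPn => a0.
  by congr esum; apply/seteqP; split=> s /= => [/spos_SomeE[]|Ms]//; apply/spos_SomeE.
rewrite (_ : accepts _ _ = set0) ?esum_set0 //.
by apply/seteqP; split=> s //= /spos_SomeE[_]; exact/negP.
Qed.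

Lemma esum_pos_mass (d : subdistr R nat) :
  \esum_(k in [set k | (0 < k)%N]) (d k)%:E = (pos_mass d)%:E.
Proof.
have t0 : 0 <= \esum_(k in [set k | (0 < k)%N]) (d k)%:E.
  by apply: esum_ge0 => k _; rewrite lee_fin sd_ge0.
rewrite /pos_mass fineK // ge0_fin_numE //.
apply: (@le_lt_trans _ _ 1); last exact: ltry.
by apply: le_trans (sd_tail_le d); rewrite leeDr // lee_fin sd_ge0.
Qed.

(** The value is summed out because the next run ignores it. Each further run, restricted to nonzero
    values, multiplies the total mass by its [pos_mass]. *)
Lemma spr_iter_pos_mass (F : nat -> sampler) (f : nat -> subdistr R nat) y :
  (forall z, samples (F z) (f z)) ->
  \esum_(a in [set: nat]) spr R (siter_pos F y) a =
  (\prod_(z < y) pos_mass (f z))%:E.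
Proof.
move=> Ff; have lF z : local (F z) by have [] := Ff z.
elim: y => [|y IH].
  rewrite big_ord0 (eq_esum (b := fun a => (sd_dirac R 0%N a)%:E)) => [|a _].
    rewrite (esumID [set 0%N]) => [|a _]; last by rewrite lee_fin sd_ge0.
    rewrite !setTI esum_set1 ?lee_fin ?sd_ge0 // esum1 => [|a /= /eqP/negbTE].
      by rewrite adde0 /= /dirac_fun eqxx.
    by rewrite /dirac_fun => ->.
  exact: spr_ret.
(* [q] is the law of [spos (F y)]: the restriction of [f y], not normalized. *)
pose q a : R := if (0 < a)%N then f y a else 0%R.
have q0 a : (0 <= q a)%R by rewrite /q; case: ifP => // _; exact: sd_ge0.
transitivity (\esum_(a in [set: nat]) ((\prod_(z < y) pos_mass (f z))%:E * (q a)%:E)).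
  apply: eq_esum => a _ /=; rewrite -IH -esumZr // => [|b]; last exact: spr_ge0.
  apply: (spr_bind (q := fun=> q a)) => [|_|_].
  - exact: local_iter_pos.
  - exact: local_pos.
  - by rewrite spr_pos /q; case: ifP => // _; have [_ ->] := Ff y.
rewrite esumZl; last 2 first.
- by apply: prodr_ge0 => z _; exact: pos_mass_ge0.
- by move=> a; rewrite lee_fin.
rewrite big_ord_recr /= EFinM -esum_pos_mass; congr (_ * _).
rewrite [RHS]esum_mkcond; apply: eq_esum => a _.
by rewrite /q; case: ifPn => a0; [rewrite mem_set|rewrite memNset //; exact/negP].
Qed.

Lemma samples_min (F : nat -> sampler) (f : nat -> subdistr R nat) :
  (forall z, samples (F z) (f z)) -> samples (smin F) (sd_min f).
Proof.
move=> Ff; have lF z : local (F z) by have [] := Ff z.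
have lI z : local (siter_pos F z) by exact: local_iter_pos.
split=> [w w' [y n] /smin_SomeE Mw ww'|y].
  by apply/smin_SomeE; apply: local_bind Mw ww'.
rewrite /spr (_ : accepts _ _ = accepts (sbind (siter_pos F y) (fun=> F y)) 0).
  rewrite -/(spr R _ _) (spr_bind (q := fun=> f y 0%N)) // => [|_].
    rewrite esumZr ?sd_ge0 // => [|a]; last exact: spr_ge0.
    by rewrite (spr_iter_pos_mass y Ff) -EFinM mulrC.
  by have [_ ->] := Ff y.
by apply/seteqP; split=> s /smin_SomeE.
Qed.

(** * From accepting strings to the coin measure, and the induction on [PR] *)

(** The event is the disjoint union of the cylinders of the accepting strings, and there are
    countably many strings. *)
Lemma coin_measure_sampler M y : local M ->
  coin_measure R [set w | omap fst (M w) = Some y] = spr R M y.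
Proof.
move=> lM.
pose D : set nat := pickle @` accepts M y.
pose C (i : nat) : set Defs.Bseq := cylinder (odflt [::] (unpickle i)).
rewrite (_ : [set w | _] = \bigcup_(i in D) C i); last first.
  apply/seteqP; split=> [w /=|w [_ [s Ms <-]]]; last first.
    by rewrite /C pickleK /= => sw; rewrite (accepts_cylinder lM Ms sw).
  case Mw: (M w) => [[a n]|] //= [ay]; subst a.
  exists (pickle (mkseq w n)); last by rewrite /C pickleK; exact: cylinder_mkseq.
  by exists (mkseq w n) => //; exact: accepts_mkseq.
rewrite measure_bigcup; last 2 first.
- by move=> i _; apply: sub_sigma_algebra; exists (odflt [::] (unpickle i)).
(* On a stream in both cylinders [M] reads a single number of bits, so [s] and [t] have the same
   length and the same bits. *)
- move=> _ _ [s Ms <-] [t Mt <-] [w []]; rewrite /C !pickleK /= => sw tw.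
  have := accepts_cylinder lM Ms sw; rewrite (accepts_cylinder lM Mt tw) => -[sz].
  congr pickle; apply: (@eq_from_nth _ false) => // i lti.
  by rewrite -sw // -tw // sz.
rewrite nneseries_esum // (_ : [set i | i \in D] = D); last first.
  by apply/seteqP; split=> i; rewrite /= inE.
rewrite /D esum_image; last by move=> s t _ _; exact: (pcan_inj pickleK).
by apply: eq_esum => s _; rewrite /C pickleK; exact: coin_measure_cylinder.
Qed.

Lemma PR_sampler m (f : m.-tuple nat -> subdistr R nat) : PR f ->
  exists M : seq nat -> sampler,
    realizable m M /\ forall x : m.-tuple nat, samples (M x) (f x).
Proof.
elim=> {m f} [||n i||n k f g _ [F [rF Ff]] _ IH|k f g _ [F [rF Ff]] _ [G [rG Gg]]
  |k f _ [F [rF Ff]]].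
- exists (fun=> sret 0); split=> [|x]; last exact: samples_ret.
  exact: realizable_ret (ORt_const 1 0).
- exists (fun x => sret (nth 0%N x 0).+1); split=> [|x].
    by apply: (realizable_ret (t := fun x => _.+1)); apply: ORt_succ; exact: ORt_nth.
  by rewrite /thead (tnth_nth 0%N); exact: samples_ret.
- exists (fun x => sret (nth 0%N x i)); split=> [|x].
    by apply: (realizable_ret (t := nth 0%N ^~ i)); exact: ORt_nth.
  by rewrite (tnth_nth 0%N); exact: samples_ret.
- exists (fun x => scoin (head 0%N x)); split=> [|x]; first exact: realizable_coin.
  by rewrite /thead (tnth_nth 0%N) nth0; exact: samples_coin.
(* The induction hypothesis gives a sampler for each [i] separately; [choice] collects them into one
   family. *)
- have [G rG] := choice IH.
  exists (fun x => scomp (fun i => G i x) F); split=> [|x].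
    have H := @realizable_comp n k 0 G F (fun i => (rG i).1) rF.
    apply: realizable_ext H _ => x _; rewrite take0 drop0.
    by congr scomp.
  by apply: samples_comp => // i; have [_] := rG i.
- exists (fun v => srec F G (nth 0%N v k) (take k v)); split=> [|v].
    exact: realizable_rec.
  rewrite /prec; set x := [tuple _ | _ < _].
  have -> : take k v = x.
    apply: (@eq_from_nth _ 0%N) => [|i].
      by rewrite size_take_min !size_tuple; apply/minn_idPl.
    rewrite size_take_min size_tuple (minn_idPl _) // => ltik.
    rewrite nth_take // -[i in RHS]/(val (Ordinal ltik)) -tnth_nth tnth_mktuple.
    by rewrite (tnth_nth 0%N).
  by rewrite (tnth_nth 0%N); exact: samples_rec.
- exists (fun x => smin (fun z => F (rcons x z))); split=> [|x].
    exact: realizable_min.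
  by apply: samples_min => z; exact: (Ff [tuple of rcons x z]).
Qed.

End Minimization.

Theorem theorem4 (R : realType) (m : nat) (f : m.-tuple nat -> subdistr R nat)
    (hf : PR f) :
  exists g : pfun m, OR g /\
    forall (x : m.-tuple nat) (y : nat), Q R g x y = (f x y)%:E.
Proof.
have [M [rM Mf]] := PR_sampler hf.
(* The realizer is started at position 0; then the value is decoded and the final position
   forgotten. *)
have H := ORs_let (ORs_substl rM (ORl_cons (ORt_const m 0) (ORl_id m)))
  (ORt_fst (@ORt_nth m.+1 0 isT)).
exists (fun x w => omap fst (M x w)); split=> [|x y].
  apply: OR_ext H _ => x w /=; rewrite /realizer /=.
  by case: (M x _) => [[a n]|] //=; rewrite pair_codeK1.
have [lM <-] := Mf x.
exact: coin_measure_sampler.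
Qed.
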